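(* Let $d\ge 6$. Then the construction is not dense for degree-$d$ curves; that is, there is no nonempty Zariski-open subset $U\subset\mathbb{P}(S_d)$ such that every curve $X\in U$ is constructible.
   Context: Let $S=\mathbb{C}[x,y,z]=\bigoplus_{d\ge 0}S_d$. Degree-$d$ curves in the complex projective plane $\mathbb{P}^2$ are identified with points of the projective space $\mathbb{P}(S_d)$ (nonzero forms of degree $d$ up to nonzero scalar), equipped with the Zariski topology. A curve $X$ of degree $d$ is called constructible if there exist $d+1$ red lines $\ell_1,\dots,\ell_{d+1}$ and $d+1$ blue lines $L_1,\dots,L_{d+1}$ in $\mathbb{P}^2$ such that the $d+1$ points $\ell_i\cap L_i$ ($1\le i\le d+1$) are collinear and the other $d(d+1)$ points $\ell_i\cap L_j$ ($i\ne j$) lie on $X$; here the $(d+1)^2$ points $\ell_i\cap L_j$ are understood to be pairwise distinct. The construction is said to be dense for degree-$d$ curves if there is a nonempty Zariski-open subset $U\subset\mathbb{P}(S_d)$ such that each $X\in U$ is constructible. *)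

(* Defs.v *)
From mathcomp Require Import all_boot all_order all_algebra.
From mathcomp Require Import mpoly complex reals.

Set Implicit Arguments.
Unset Strict Implicit.
Unset Printing Implicit Defensive.

Import GRing.Theory.
Local Open Scope ring_scope.

(* P(V): its points are the one-dimensional subspaces of V, i.e. the nonzero
   vectors up to nonzero scalar. *)
Definition proj (K : fieldType) (V : vectType K) : Type :=
  {P : {vspace V} | \dim P == 1%N}.

(* A form vanishes at a point when it vanishes on all its representatives;
   the forms on V are the homogeneous polynomials in the coordinates relative to
   the library's chosen basis of V.  Changing the basis is a linear change of
   variables, so the closed sets below do not depend on this choice. *)
Definition form_vanishes (K : fieldType) (V : vectType K)
    (g : {mpoly K[\dim {:V}]}) (P : proj V) : Prop :=
  forall v : V, v \in val P ->
    g.@[fun i => coord (vbasis {:V}) i v] = 0.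

Definition zariski_closed (K : fieldType) (V : vectType K)
    (Z : proj V -> Prop) : Prop :=
  exists2 G : {mpoly K[\dim {:V}]} -> Prop,
    (forall g, G g -> exists m : nat, g \is m.-homog) &
    (forall P, Z P <-> (forall g, G g -> form_vanishes g P)).

Definition zariski_open (K : fieldType) (V : vectType K)
    (U : proj V -> Prop) : Prop :=
  zariski_closed (fun P => ~ U P).

Definition plane (K : fieldType) : Type := proj 'rV[K]_3.

(* Lines of the plane are the two-dimensional subspaces of K^3. *)
Definition line (K : fieldType) : Type :=
  {l : {vspace 'rV[K]_3} | \dim l == 2%N}.

Definition on_line (K : fieldType) (P : plane K) (l : line K) : Prop :=
  (val P <= val l)%VS.

(* P(S_d), where S = K[x,y,z]. *)
Definition curve (K : fieldType) (d : nat) : Type := proj (dhomog 3 K d).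

Definition on_curve (K : fieldType) (d : nat) (P : plane K) (X : curve K d) :
    Prop :=
  forall (f : dhomog 3 K d) (v : 'rV[K]_3), f \in val X -> v \in val P ->
    (mpoly_of_dhomog f).@[fun i => v 0 i] = 0.

Definition collinear (K : fieldType) (I : Type) (p : I -> plane K) : Prop :=
  exists m : line K, forall i, on_line (p i) m.

(* p i j is the point where l i and L j meet; that it exists as an element of
   [plane K] forces l i and L j to be distinct lines. *)
Definition constructible (K : fieldType) (d : nat) (X : curve K d) : Prop :=
  exists (l L : 'I_d.+1 -> line K) (p : 'I_d.+1 -> 'I_d.+1 -> plane K),
    [/\ forall i j, val (p i j) = (val (l i) :&: val (L j))%VS,
        forall i j i' j', p i j = p i' j' -> i = i' /\ j = j',
        collinear (fun i => p i i)
      & forall i j, i <> j -> on_curve (p i j) X].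

Definition construction_dense (K : fieldType) (d : nat) : Prop :=
  exists U : curve K d -> Prop,
    [/\ zariski_open U,
        exists X, U X
      & forall X, U X -> constructible X].

(* Main.v *)
Require Import Defs.
From Stdlib Require Import Classical.
From mathcomp Require Import all_boot all_order all_algebra.
From mathcomp Require Import mpoly complex reals ring zify.

Set Implicit Arguments.
Unset Strict Implicit.
Unset Printing Implicit Defensive.

Import Order.TTheory GRing.Theory Num.Theory.
Local Open Scope ring_scope.

(** The constructible curves depend on too few parameters.

    Let [l i], [L i] be the red and blue lines of a constructible curve, and let
    [mu] be an equation of the line [m] that carries the diagonal points.  No
    red or blue line equals [m]: it would contain all the diagonal points, whereas
    it contains just one, as the grid points are distinct.  The lines [l i], [L i]
    and [m] are concurrent, so equations [a i] of [l i] can be scaled in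
    such a way that [a i - mu] is an equation of [L i] ([grid_forms]).  Then
      F = (\prod_i a i - \prod_i (a i - mu)) / mu
    is a form of degree d ([grid_form]) which vanishes at every off-diagonal
    point: both products do, and [mu] does not ([grid_form_vanish]).

    Up to a scalar, F is the only such form.  Indeed, a form of degree d that
    vanishes off the diagonal and also at one diagonal point has d + 1 zeros on
    one red line, hence vanishes on it; it then has d + 1 zeros on each of the
    other red lines, and so vanishes on d + 1 distinct lines, which is too much
    for its degree ([grid_vanish]).  Since F is not zero at that diagonal point
    ([grid_form_neq0]), subtracting a multiple of F gives uniqueness.

    So every equation of a constructible curve is c F, a polynomial expression in
    the 3 (d + 2) + 1 parameters given by [a], [mu] and c.  For 6 <= d this is
    smaller than 'C(d + 2, 2), the dimension of the space of forms of degree d,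
    so the coefficients of c F satisfy a fixed nontrivial polynomial relation
    ([algebraic_dependence]), whereas no such relation holds on a nonempty open
    set ([open_not_parametrized]). *)

(** * Nonvanishing values of polynomials *)

Lemma poly_nonroot (K : numFieldType) (p : {poly K}) :
  p != 0 -> exists2 c : K, c != 0 & p.[c] != 0.
Proof.
move=> p0; pose rs : seq K := [seq i.+1%:R | i <- iota 0 (size p)].
have urs : uniq rs.
  rewrite map_inj_uniq ?iota_uniq // => i j /eqP.
  by rewrite eqr_nat => /eqP [].
have : ~~ all (root p) rs.
  by apply/negP => /(max_poly_roots p0)/(_ urs); rewrite size_map size_iota ltnn.
by case/allPn => _ /mapP[i _ ->] nr; exists i.+1%:R; rewrite ?pnatr_eq0.
Qed.

(** Induction on the number of variables: the part of [p] of some fixed degree in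
    the last variable does not vanish at some point [v] of the remaining
    variables, so that [p] at [v] is a nonzero univariate polynomial. *)
Lemma mpoly_nonzero (K : numFieldType) (n : nat) (p : {mpoly K[n]}) :
  p != 0 -> exists v : 'I_n -> K, p.@[v] != 0.
Proof.
elim: n p => [|n IHn] p p0.
  exists (fun=> 0); rewrite mevalE.
  have /msize_poly1P[c c0 ->] : msize p == 1%N.
    rewrite eqn_leq lt0n msize_poly_eq0 p0 andbT msizeE.
    apply/bigmax_leqP_seq => m _ _; rewrite mdegE big_ord0 //.
  by rewrite -mevalE mevalC.
pose w (m : 'X_{1..n.+1}) := [multinom m (widen_ord (leqnSn n) i) | i < n].
pose m0 := mlead p.
pose q : {mpoly K[n]} :=
  \sum_(m <- msupp p | m ord_max == m0 ord_max) p@_m *: 'X_[w m].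
have q0 : q != 0.
  apply/eqP => /(congr1 (mcoeff (w m0))); rewrite mcoeff0 raddf_sum /= => /eqP.
  rewrite big_mkcond (bigD1_seq m0) ?msupp_uniq ?mlead_supp //= eqxx.
  rewrite mcoeffZ mcoeffX eqxx mulr1 big1 ?addr0 => [|m mm0].
    by rewrite mleadc_eq0 (negPf p0).
  case: ifP => // /eqP em; rewrite mcoeffZ mcoeffX.
  case: eqP => [ew|]; last by rewrite mulr0.
  case/eqP: mm0; apply/mnmP => i.
  case: (unliftP ord_max i) => [j ->|->] //.
  have -> : lift ord_max j = widen_ord (leqnSn n) j.
    by apply/val_inj; rewrite /= /bump leqNgt ltn_ord.
  by move/mnmP: ew => /(_ j); rewrite !mnmE.
have [v qv] := IHn q q0.
pose P : {poly K} := \sum_(m <- msupp p) (p@_m * \prod_i v i ^+ w m i) *: 'X^(m ord_max).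
have P0 : P != 0.
  (* The coefficient of degree m0 ord_max of P is the value of q at v. *)
  apply: contra qv => /eqP/(congr1 (coefp (m0 ord_max))); rewrite /= coef0 => Pm.
  rewrite -[X in _ == X]Pm; apply/eqP; rewrite coef_sum /q raddf_sum /= [LHS]big_mkcond; apply: eq_bigr => m _.
  rewrite coefZ coefXn eq_sym; case: eqP => _; last by rewrite mulr0.
  by rewrite mevalZ mevalX mulr1.
have [c _ Pc] := poly_nonroot P0.
exists (fun i => if unlift ord_max i is Some j then v j else c).
suff <- : P.[c] = p.@[fun i => if unlift ord_max i is Some j then v j else c] by [].
rewrite mevalE horner_sum; apply: eq_bigr => m _.
rewrite hornerZ hornerXn -mulrA big_ord_recr /= unlift_none; congr (_ * (_ * _)).
apply: eq_bigr => i _; rewrite mnmE; congr (_ ^+ _).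
have -> : widen_ord (leqnSn n) i = lift ord_max i.
  by apply/val_inj; rewrite /= /bump leqNgt ltn_ord.
by rewrite liftK.
Qed.

(** * Algebraic dependence and open sets *)

Lemma msizeM_leS (K : fieldType) (n a b : nat) (p q : {mpoly K[n]}) :
  (msize p <= a.+1 -> msize q <= b.+1 -> msize (p * q) <= (a + b).+1)%N.
Proof.
have [->|p0] := eqVneq p 0; first by rewrite mul0r msize0.
have [->|q0] := eqVneq q 0; first by rewrite mulr0 msize0.
by rewrite msizeM //; move: (msize p) (msize q) => s t; lia.
Qed.

Lemma card_bmultinom (n b : nat) : (#|{: 'X_{1..n < b}}| <= b ^ n)%N.
Proof.
pose h (m : 'X_{1..n < b}) : {ffun 'I_n -> 'I_b} :=
  [ffun i => Ordinal (leq_ltn_trans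
     (leq_trans (leq_addr _ _) (eq_leq (esym (etrans (mdegE m) (bigD1 i isT)))))
     (bmdeg m))].
have hI : injective h.
  move=> m1 m2 /ffunP h12; apply/val_inj/mnmP => i.
  by have := congr1 val (h12 i); rewrite !ffunE.
by have := leq_card h hI; rewrite card_ffun !card_ord.
Qed.

(** Counting monomials.  If each [Phi i] has size at most D, the k ^ N products
    of powers of the [Phi i] with exponents below k lie in the space of
    polynomials of size at most k (N D + 1), whose dimension is at most
    (k (N D + 1)) ^ n.  As n < N, for large k there are more products than
    dimensions, and a linear relation between them is the polynomial G. *)
Lemma algebraic_dependence (K : fieldType) (n N : nat)
    (Phi : 'I_N -> {mpoly K[n]}) :
  (n < N)%N ->
  exists2 G : {mpoly K[N]}, G != 0 & forall t, G.@[fun i => (Phi i).@[t]] = 0.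
Proof.
move=> ltnN.
pose D := \max_i msize (Phi i).
pose C := (N * D).+1.
pose k := (C ^ n).+1.
pose T := {ffun 'I_N -> 'I_k}.
(* All monomials of the products lie in B, by size_pol below. *)
pose B := 'X_{1..n < k * C}.
pose mon (e : T) : 'X_{1..N} := [multinom (e i : nat) | i < N].
pose pol (e : T) : {mpoly K[n]} := \prod_i Phi i ^+ e i.
have monI : injective mon.
  move=> e1 e2 /mnmP e12; apply/ffunP => i; apply/val_inj.
  by have := e12 i; rewrite !mnmE.
have cardTB : (#|{: B}| < #|{: T}|)%N.
  apply: (leq_ltn_trans (card_bmultinom _ _)).
  rewrite card_ffun !card_ord; apply: (@leq_trans (k ^ n.+1)).
    by rewrite expnMn expnS mulnC ltn_pmul2r ?expn_gt0.
  by rewrite leq_pexp2l.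
have size_pol e : (msize (pol e) <= k * C)%N.
  suff : (msize (pol e) <= (\sum_(i < N) D * e i).+1)%N.
    move/leq_trans; apply; rewrite -big_distrr /=.
    have : (\sum_(i < N) e i <= \sum_(i < N) k.-1)%N.
      by apply: leq_sum => i _; rewrite -ltnS prednK // ltn_ord.
    rewrite sum_nat_const card_ord /C /k /=; move: (\sum_(i < N) _)%N => s.
    move=> hs; have : (D * s <= D * (N * C ^ n))%N by rewrite leq_mul2l hs orbT.
    rewrite /C; move: (_ ^ _)%N; nia.
  rewrite /pol; elim/big_rec2: _ => [|i s p _ IH]; first by rewrite msize1.
  apply: msizeM_leS => //.
  elim: (nat_of_ord (e i)) => [|j IHj]; first by rewrite expr0 msize1 muln0.
  rewrite exprS mulnS; apply: msizeM_leS => //.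
  by rewrite leqW // /D (leq_bigmax i).
pose M := \matrix_(i < #|{: T}|, j < #|{: B}|) (pol (enum_val i))@_(enum_val j).
have kM : kermx M != 0.
  rewrite kermx_eq0 -row_leq_rank -ltnNge.
  exact: leq_ltn_trans (rank_leq_col _) cardTB.
pose u := nz_row (kermx M).
have u0 : u != 0 by rewrite nz_row_eq0.
have uM : u *m M = 0 by apply/sub_kermxP; exact: nz_row_sub.
pose G : {mpoly K[N]} := \sum_i u 0 i *: 'X_[mon (enum_val i)].
have dep : \sum_i u 0 i *: pol (enum_val i) = 0.
  apply/mpolyP => m; rewrite mcoeff0 raddf_sum /=.
  case: (ltnP (mdeg m) (k * C)) => hm.
    pose b : B := BMultinom hm.
    move/matrixP: uM => /(_ 0 (enum_rank b)); rewrite !mxE => uM0.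
    rewrite -[RHS]uM0; apply: eq_bigr => i _.
    by rewrite mcoeffZ mxE enum_rankK.
  apply: big1 => i _; rewrite mcoeffZ memN_msupp_eq0 ?mulr0 //.
  by apply: msize_mdeg_ge; apply: leq_trans hm.
exists G => [|t].
  apply: contra u0 => /eqP G0; apply/eqP/rowP => i; rewrite mxE.
  move/(congr1 (mcoeff (mon (enum_val i)))): G0.
  rewrite mcoeff0 raddf_sum /= (bigD1 i) //= mcoeffZ mcoeffX eqxx mulr1.
  rewrite big1 ?addr0 // => j ji; rewrite mcoeffZ mcoeffX.
  by rewrite (inj_eq monI) (inj_eq enum_val_inj) (negPf ji) mulr0.
rewrite -(@meval0 _ _ t) -dep !raddf_sum /=; apply: eq_bigr => i _.
rewrite !mevalZ mevalX rmorph_prod; congr (_ * _).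
by apply: eq_bigr => j _; rewrite rmorphXn /= mnmE.
Qed.

(** A relation G between the [Phi i] and a form g that vanishes off [U] but not
    everywhere have a product which does not vanish at some vector.  That vector
    spans a point of [U], hence is parametrized, but G is not zero at it. *)
Lemma open_not_parametrized (K : numFieldType) (V : vectType K) (n : nat)
    (Phi : 'I_(\dim {:V}) -> {mpoly K[n]}) (U : proj V -> Prop) :
  (n < \dim {:V})%N -> zariski_open U -> (exists P, U P) ->
  ~ (forall P, U P -> forall v, v \in val P -> v != 0 ->
       exists t, forall i, coord (vbasis {:V}) i v = (Phi i).@[t]).
Proof.
move=> ltn [C _ CU] [P0 UP0] param.
have [g Cg [x xP gx]] : exists2 g, C g &
    exists2 v, v \in val P0 & g.@[fun i => coord (vbasis {:V}) i v] <> 0.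
  apply: NNPP => nog; case: (CU P0) => _; apply=> // g Cg v vP.
  by apply: NNPP => gv; apply: nog; exists g => //; exists v.
have g0 : g != 0 by apply/eqP => g0; apply: gx; rewrite g0 meval0.
have [G G0 GPhi] := algebraic_dependence Phi ltn.
pose i0 : 'I_(\dim {:V}) := Ordinal (leq_ltn_trans (leq0n n) ltn).
(* The factor 'X_i0 makes the vector with coordinates c nonzero. *)
have [c] : exists c, (G * (g * 'X_i0)).@[c] != 0.
  by apply: mpoly_nonzero; rewrite !mulf_neq0 // -msize_poly_eq0 msizeX.
rewrite !mevalM mevalXU !mulf_eq0 !negb_or => /and3P[Gc gc ci0].
pose v := \sum_i c i *: (vbasis {:V})`_i.
have cv i : coord (vbasis {:V}) i v = c i.
  by rewrite coord_sum_free // (basis_free (vbasisP _)).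
have v0 : v != 0.
  by apply: contra ci0 => /eqP v0; rewrite -cv v0 linear0.
have dv : \dim <[v]>%VS == 1%N by rewrite dim_vline v0.
pose P : proj V := exist _ <[v]>%VS dv.
have UP : U P.
  apply: NNPP => /CU/(_ g Cg v (memv_line v)).
  by rewrite (meval_eq _ cv) => /eqP; rewrite (negPf gc).
have [t Phit] := param P UP v (memv_line v) v0.
case/eqP: Gc; rewrite -[RHS](GPhi t).
by apply: meval_eq => i; rewrite -cv Phit.
Qed.

(** * Zeros of forms along a line *)

Lemma meval_scale (K : comNzRingType) (n d : nat) (f : {mpoly K[n]}) (c : K)
    (v : 'I_n -> K) :
  f \is d.-homog -> f.@[fun i => c * v i] = c ^+ d * f.@[v].
Proof.
move=> hf; rewrite !mevalE big_distrr /=; apply: eq_big_seq => m mf.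
have <- : mdeg m = d by exact: (dhomog_mf hf mf).
rewrite mulrCA; congr (_ * _); rewrite mdegE -prodrXr -big_split.
by apply: eq_bigr => i _; rewrite exprMn.
Qed.

(** The restriction of [f] to the affine line through [a] with direction [b].  The
    substitution is written out on monomials so that its degree can be bounded
    termwise. *)
Definition restrict_line (K : comNzRingType) (n : nat) (f : {mpoly K[n]})
    (a b : 'I_n -> K) : {poly K} :=
  \sum_(m <- msupp f) f@_m *: \prod_i ((a i)%:P + b i *: 'X) ^+ m i.

Lemma restrict_lineE (K : comNzRingType) (n : nat) (f : {mpoly K[n]})
    (a b : 'I_n -> K) (t : K) :
  (restrict_line f a b).[t] = f.@[fun i => a i + b i * t].
Proof.
rewrite horner_sum mevalE; apply: eq_bigr => m _.
rewrite hornerZ horner_prod; congr (_ * _); apply: eq_bigr => i _.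
by rewrite horner_exp !hornerE.
Qed.

Lemma size_restrict_line (K : fieldType) (n d : nat) (f : {mpoly K[n]})
    (a b : 'I_n -> K) :
  f \is d.-homog -> (size (restrict_line f a b) <= d.+1)%N.
Proof.
move=> hf; rewrite /restrict_line big_seq.
apply: (big_ind (fun p : {poly K} => (size p <= d.+1)%N)) => [|p q hp hq|m mf].
- by rewrite size_poly0.
- by apply: leq_trans (size_polyD _ _) _; rewrite geq_max hp.
apply: leq_trans (size_scale_leq _ _) _.
have <- : mdeg m = d by exact: (dhomog_mf hf mf).
rewrite mdegE.
elim/big_rec2: _ => [|i s p _ IH]; first by rewrite size_poly1.
apply: leq_trans (size_polyMleq _ _) _.
have : (size (((a i)%:P + b i *: 'X)%R ^+ m i)%R <= (m i).+1)%N.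
  apply: leq_trans (size_poly_exp_leq _ _) _; rewrite ltnS.
  rewrite -[leqRHS]mul1n leq_mul2r -ltnS; apply/orP; right.
  have: (size ((a i)%:P + b i *: 'X)%R <= 2)%N.
    apply: leq_trans (size_polyD _ _) _; rewrite geq_max size_polyC.
    rewrite (leq_trans (size_scale_leq _ _)) ?size_polyX // andbT.
    by case: (a i != 0).
  by case: size.
move: (size _) (size _) IH => x y; lia.
Qed.

(** The points with homogeneous coordinates [s i], [t i] on the line through [q]
    and [w] are d + 1 distinct zeros, too many for a nonzero polynomial of degree
    at most d in an affine coordinate. *)
Lemma homog_vanish_span2 (K : numFieldType) (n d : nat) (f : {mpoly K[n]})
    (q w : 'I_n -> K) (s t : 'I_d.+1 -> K) :
  f \is d.-homog ->
  (forall i j, i != j -> s i * t j != s j * t i) ->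
  (forall i, f.@[fun k => s i * q k + t i * w k] = 0) ->
  (0 < d)%N -> f.@[q] = 0.
Proof.
move=> hf st fst d_gt0.
have [/existsP[i /eqP ti0]|/existsPn t0] := boolP [exists i, t i == 0].
  have [j ij] : exists j, i != j.
    have [->|i0] := eqVneq i ord0; last by exists ord0.
    by exists (inord 1); rewrite -val_eqE /= inordK.
  have si0 : s i != 0.
    by apply: contra (st i j ij) => /eqP ->; rewrite ti0 mul0r mulr0.
  have := fst i; rewrite ti0.
  rewrite (@meval_eq _ _ _ (fun k => s i * q k)); last by move=> k; rewrite mul0r addr0.
  by rewrite (meval_scale _ _ hf) => /eqP; rewrite mulf_eq0 expf_eq0 (negPf si0) andbF => /eqP.
(* None of the zeros is at q: in the chart t = 1 they are distinct roots. *)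
have P0 : restrict_line f w q = 0.
  apply/eqP/negPn/negP => P0.
  pose rs := [seq s i / t i | i <- enum 'I_d.+1].
  have urs : uniq rs.
    rewrite map_inj_in_uniq ?enum_uniq // => i j _ _ e; apply/eqP/negPn/negP.
    move/st; rewrite -[s i](divfK (t0 i)) e => /eqP; apply.
    by rewrite mulrAC divfK.
  have : all (root (restrict_line f w q)) rs.
    apply/allP => _ /mapP[i _ ->]; rewrite rootE restrict_lineE.
    apply/eqP; apply: (mulfI (expf_neq0 d (t0 i))).
    rewrite -(meval_scale _ _ hf) mulr0 -[RHS](fst i).
    by apply: meval_eq => k; rewrite mulrDr addrC; congr (_ + _); field.
  move/(max_poly_roots P0)/(_ urs); rewrite size_map size_enum_ord.
  by rewrite ltnNge size_restrict_line.
(* In the chart s = 1, where q is the origin, f vanishes away from the origin,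
   hence also there. *)
have : restrict_line f q w = 0.
  apply/eqP/negPn/negP => /poly_nonroot[c c0].
  rewrite restrict_lineE.
  rewrite (@meval_eq _ _ _ (fun k => c * (w k + q k * c^-1))).
    by rewrite (meval_scale _ _ hf) -restrict_lineE P0 horner0 mulr0 eqxx.
  by move=> k; field.
move/(congr1 (horner^~ 0)); rewrite restrict_lineE horner0 => <-.
by apply: meval_eq => k; rewrite mulr0 addr0.
Qed.

(** * Linear forms and subspaces of codimension one *)

Definition lform (R : comNzRingType) (n : nat) (a : 'I_n -> R) : {mpoly R[n]} :=
  \sum_i a i *: 'X_i.

Lemma eq_lform (R : comNzRingType) (n : nat) (a b : 'I_n -> R) :
  a =1 b -> lform a = lform b.
Proof. by move=> ab; apply: eq_bigr => i _; rewrite ab. Qed.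

Lemma lformE (R : comNzRingType) (n : nat) (a v : 'I_n -> R) :
  (lform a).@[v] = \sum_i a i * v i.
Proof.
by rewrite raddf_sum /=; apply: eq_bigr => i _; rewrite mevalZ mevalXU.
Qed.

Lemma map_lform (R S : comNzRingType) (h : {rmorphism R -> S}) (n : nat)
    (a : 'I_n -> R) :
  map_mpoly h (lform a) = lform (h \o a).
Proof.
rewrite raddf_sum /=; apply: eq_bigr => i _.
by rewrite map_mpolyZ map_mpolyX.
Qed.

Lemma lform_homog (R : comNzRingType) (n : nat) (a : 'I_n -> R) :
  lform a \is 1.-homog.
Proof.
by apply: rpred_sum => i _; apply: rpredZ; rewrite dhomogX /= mdeg1.
Qed.

Lemma lform_neq0 (R : comNzRingType) (n : nat) (a v : 'I_n -> R) :
  \sum_i a i * v i != 0 -> lform a != 0.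
Proof. by apply: contra => /eqP a0; rewrite -lformE a0 meval0. Qed.

Definition dot (K : fieldType) (n : nat) (a v : 'rV[K]_n) : K :=
  \sum_k a 0 k * v 0 k.

Lemma dotC (K : fieldType) (n : nat) (a v : 'rV[K]_n) : dot a v = dot v a.
Proof. by apply: eq_bigr => k _; rewrite mulrC. Qed.

Lemma dotZ (K : fieldType) (n : nat) (c : K) (a v : 'rV[K]_n) :
  dot (c *: a) v = c * dot a v.
Proof. by rewrite /dot big_distrr /=; apply: eq_bigr => k _; rewrite mxE mulrA. Qed.

Lemma dotB (K : fieldType) (n : nat) (a b v : 'rV[K]_n) :
  dot (a - b) v = dot a v - dot b v.
Proof.
by rewrite /dot -sumrB; apply: eq_bigr => k _; rewrite !mxE mulrBl.
Qed.

Lemma dot0 (K : fieldType) (n : nat) (v : 'rV[K]_n) : dot 0 v = 0.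
Proof. by rewrite -(subrr 0) dotB subrr. Qed.

Lemma lform_dot (K : fieldType) (n : nat) (a v : 'rV[K]_n) :
  (lform (a 0)).@[v 0] = dot a v.
Proof. exact: lformE. Qed.

Definition formker (K : fieldType) (n : nat) (a : 'rV[K]_n) : {vspace 'rV[K]_n} :=
  lker (linfun (mulmxr a^T)).

Lemma mem_formker (K : fieldType) (n : nat) (a v : 'rV[K]_n) :
  (v \in formker a) = (dot a v == 0).
Proof.
rewrite memv_ker lfunE /=; have -> : v *m a^T = (dot a v)%:M.
  apply/rowP => i; rewrite ord1 !mxE; apply: eq_bigr => k _.
  by rewrite mxE mulrC.
by rewrite -scalemx1 scaler_eq0 oner_eq0 orbF.
Qed.

Lemma dim_rV (K : fieldType) (n : nat) : \dim {:'rV[K]_n} = n.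
Proof. by rewrite dimvf /dim /= mul1n. Qed.

Lemma dim_formker (K : fieldType) (n : nat) (a : 'rV[K]_n.+1) :
  a != 0 -> \dim (formker a) = n.
Proof.
move=> a0; pose f : 'Hom('rV[K]_n.+1, 'rV[K]_1) := linfun (mulmxr a^T).
have := limg_ker_dim f fullv.
rewrite capfv -/(formker a) dim_rV => dimE.
have : (\dim (limg f) <= 1)%N.
  by rewrite (leq_trans (dimvS (subvf _))) ?dim_rV.
suff : (\dim (formker a) < n.+1)%N by move: dimE; move: (\dim _) (\dim _); lia.
rewrite -[ltnRHS](dim_rV K) ltn_neqAle dimvS ?subvf // andbT.
apply: contra a0 => /eqP e; apply/eqP/rowP => k; rewrite mxE.
have : delta_mx 0 k \in formker a.
  suff /eqP -> : formker a == fullv by rewrite memvf.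
  by rewrite eqEdim subvf e leqnn.
rewrite mem_formker /dot (bigD1 k) //= mxE !eqxx mulr1 big1 ?addr0.
  by move/eqP.
by move=> j jk; rewrite mxE (negPf jk) andbF mulr0.
Qed.

Lemma mem_vlineC (K : fieldType) (V : vectType K) (u w : V) :
  w != 0 -> w \in <[u]>%VS -> u \in <[w]>%VS.
Proof.
move=> w0 /vlineP[c wE]; apply/vlineP; exists c^-1.
rewrite wE scalerA mulVf ?scale1r //.
by apply: contra w0 => /eqP c0; rewrite wE c0 scale0r.
Qed.

Lemma line_through (K : fieldType) (V : vectType K) (l : {vspace V}) (u w : V) :
  \dim l = 2%N -> u != 0 -> u \in l -> w \in l -> w \notin <[u]>%VS ->
  l = (<[u]> + <[w]>)%VS.
Proof.
move=> dl u0 ul wl wu; apply/eqP; rewrite eq_sym eqEdim subv_add -!memvE ul wl /= dl.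
have w0 : w != 0 by apply: contra wu => /eqP ->; rewrite mem0v.
rewrite dimv_disjoint_sum ?dim_vline ?u0 ?w0 //; apply/eqP; rewrite -subv0.
apply/subvP => y; rewrite memv_cap memv0 => /andP[yu yw]; apply: contraR wu => y0.
case/vlineP: yu yw y0 => c -> /vlineP[e ee] cu0.
apply/vlineP; exists (c / e); rewrite mulrC -scalerA ee scalerA mulVf ?scale1r //.
by apply: contra cu0 => /eqP e0; rewrite ee e0 scale0r.
Qed.

Lemma meet_lines (K : fieldType) (l l' : {vspace 'rV[K]_3}) :
  \dim l = 2%N -> \dim l' = 2%N -> exists2 u, u != 0 & (u \in l) && (u \in l').
Proof.
move=> dl dl'; have := dimv_sum_cap l l'; rewrite dl dl'.
have := dimvS (subvf (l + l')%VS); rewrite dim_rV => le3 sum4.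
exists (vpick (l :&: l')%VS).
  by rewrite vpick0 -dimv_eq0; move: le3 sum4; move: (\dim _) (\dim _); lia.
by have := memv_pick (l :&: l')%VS; rewrite memv_cap.
Qed.

(** By duality, an equation of the line through [u] and [w] is a common zero of
    [u] and [w] seen as linear forms. *)
Lemma line_form (K : fieldType) (l : {vspace 'rV[K]_3}) :
  \dim l = 2%N -> exists2 a, a != 0 & l = formker a.
Proof.
move=> dl; pose u := vpick l.
have u0 : u != 0 by rewrite vpick0 -dimv_eq0 dl.
have [w wl wu] : exists2 w, w \in l & w \notin <[u]>%VS.
  by apply/subvPn; apply/negP => /dimvS; rewrite dl dim_vline u0.
have w0 : w != 0 by apply: contra wu => /eqP ->; rewrite mem0v.
have [a a0 /andP[]] := meet_lines (dim_formker u0) (dim_formker w0).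
rewrite !mem_formker !(dotC _ a) -!mem_formker => ua wa.
exists a => //.
rewrite (line_through dl u0 (memv_pick l) wl wu).
by rewrite (line_through (dim_formker a0) u0 ua wa wu).
Qed.

Lemma homog_vanish_line (K : numFieldType) (d : nat) (f : {mpoly K[3]})
    (l : {vspace 'rV[K]_3}) (x : 'I_d.+1 -> 'rV[K]_3) :
  (0 < d)%N -> f \is d.-homog -> \dim l = 2%N ->
  (forall i, x i \in l) -> (forall i j, i != j -> x i \notin <[x j]>%VS) ->
  (forall i, f.@[x i 0] = 0) ->
  forall q, q \in l -> f.@[q 0] = 0.
Proof.
move=> d0 hf dl xl xx fx q ql; pose w := x ord0.
have [qw|qw] := boolP (q \in <[w]>%VS).
  case/vlineP: qw => c ->; rewrite (@meval_eq _ _ _ (fun k => c * w 0 k)).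
    by rewrite (meval_scale _ _ hf) fx mulr0.
  by move=> k; rewrite mxE.
have w0 : w != 0.
  have n0 : ord0 != ord_max :> 'I_d.+1 by rewrite -val_eqE /= eq_sym -lt0n.
  by apply: contra (xx _ _ n0) => /eqP; rewrite /w => ->; rewrite mem0v.
have st i : exists p : K * K, x i = p.1 *: q + p.2 *: w.
  have := xl i; rewrite (line_through dl w0 (xl ord0) ql qw).
  case/memv_addP => _ /vlineP[t ->] [_ /vlineP[s ->] ->].
  by exists (s, t); rewrite addrC.
have [p pE] : exists p : 'I_d.+1 -> K * K, forall i, x i = (p i).1 *: q + (p i).2 *: w.
  exact: (fin_all_exists st).
apply: (homog_vanish_span2 (w := w 0) (s := fun i => (p i).1) (t := fun i => (p i).2) hf) => //.
  move=> i j ij; apply: contra (xx i j ij) => /eqP e.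
  have xj0 : x j != 0.
    by apply: contraNneq (xx j i _) => [->|]; rewrite ?mem0v // eq_sym.
  have e1 : (p j).1 *: x i = (p i).1 *: x j.
    by rewrite (pE i) (pE j) !scalerDr !scalerA mulrC -e.
  have e2 : (p j).2 *: x i = (p i).2 *: x j.
    rewrite (pE i) (pE j) !scalerDr !scalerA (mulrC (p j).2 (p i).1) e.
    by rewrite (mulrC (p j).1 (p i).2) (mulrC (p j).2).
  apply/vlineP; have [s0|s0] := eqVneq (p j).1 0; last first.
    by exists ((p i).1 / (p j).1); rewrite mulrC -scalerA -e1 scalerA mulVf ?scale1r.
  have t0 : (p j).2 != 0.
    by apply: contra xj0 => /eqP t0; rewrite (pE j) s0 t0 !scale0r addr0.
  by exists ((p i).2 / (p j).2); rewrite mulrC -scalerA -e2 scalerA mulVf ?scale1r.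
move=> i; rewrite -[RHS](fx i); apply: meval_eq => k.
by rewrite pE !mxE.
Qed.

Lemma lines_general_point (K : numFieldType) (n : nat) (I : finType)
    (a : I -> 'rV[K]_n) :
  (forall i, a i != 0) -> exists w, forall i, dot (a i) w != 0.
Proof.
move=> a0; have [v] : exists v, (\prod_i lform (a i 0)).@[v] != 0.
  apply: mpoly_nonzero; rewrite prodf_seq_neq0; apply/allP => i _ /=.
  have /rV0Pn[k aik] := a0 i.
  apply: (@lform_neq0 _ _ _ (fun j => (j == k)%:R)).
  rewrite (bigD1 k) //= eqxx mulr1 big1 ?addr0 // => j /negPf ->.
  by rewrite mulr0.
rewrite rmorph_prod /= prodf_seq_neq0 => /allP vP.
exists (\row_k v k) => i; have := vP i (mem_index_enum i); rewrite /= lformE.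
by rewrite /dot; under [in X in _ -> X]eq_bigr do rewrite mxE.
Qed.

(** Through any point [q] off the given lines there is a line that meets them in
    d + 1 distinct points: its second point [w] has only to avoid the lines
    joining [q] to their pairwise intersections. *)
Lemma homog_vanish_lines (K : numFieldType) (d : nat) (f : {mpoly K[3]})
    (l : 'I_d.+1 -> {vspace 'rV[K]_3}) :
  (0 < d)%N -> f \is d.-homog -> (forall i, \dim (l i) = 2%N) ->
  (forall i j, i != j -> ~~ (l i <= l j)%VS) ->
  (forall i q, q \in l i -> f.@[q 0] = 0) -> f = 0.
Proof.
move=> d0 hf dl ll fl.
suff key (q : 'rV[K]_3) : f.@[q 0] = 0.
  apply/eqP/negPn/negP => /mpoly_nonzero[v]; case/negP.
  by rewrite -(key (\row_k v k)); apply/eqP/meval_eq => k; rewrite mxE.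
have aP i : exists a, l i = formker a by have [a] := line_form (dl i); exists a.
have [a aE] := fin_all_exists aP.
have [/existsP[i qi]|/existsPn ql] := boolP [exists i, q \in l i]; first exact: fl qi.
have aq i : dot (a i) q != 0 by rewrite -mem_formker -aE.
(* For i != j, b (i, j) is an equation of the line joining q to the intersection
   of l i and l j; the diagonal is filled with nonzero forms, so that the family
   is indexed by all pairs. *)
pose b (p : 'I_d.+1 * 'I_d.+1) : 'rV[K]_3 :=
  if p.1 == p.2 then a p.1 else dot (a p.1) q *: a p.2 - dot (a p.2) q *: a p.1.
have b0 p : b p != 0.
  case: p => i j; rewrite /b /=; case: (eqVneq i j) => [_|ij].
    by apply: contraNneq (aq i) => ->; rewrite dot0.
  have /subvPn[z zi zj] := ll i j ij.
  apply: contraNneq zj => e; rewrite aE mem_formker.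
  move/(congr1 (fun u => dot u z)): e; rewrite dotB !dotZ dot0.
  move: zi; rewrite aE mem_formker => /eqP ->; rewrite mulr0 subr0 => /eqP.
  by rewrite mulf_eq0 (negPf (aq i)).
have [w wb] := lines_general_point b0.
apply: (homog_vanish_span2 (w := w 0) (s := fun i => dot (a i) w)
   (t := fun i => - dot (a i) q) hf) => // [i j ij|i].
  have := wb (i, j); rewrite /b /= (negPf ij) dotB !dotZ subr_eq0.
  by rewrite !mulrN eqr_opp mulrC (mulrC (dot (a j) q)) eq_sym.
rewrite -[RHS](fl i (dot (a i) w *: q - dot (a i) q *: w)); last first.
  by rewrite aE mem_formker dotC dotB !dotZ !(dotC _ (a i)) mulrC subrr.
by apply: meval_eq => k; rewrite !mxE mulNr.
Qed.

(** * The form attached to a grid *)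

(** The quotient of \prod_(a <- s) a - \prod_(a <- s) (a - m) by [m], see
    [shift_quotientE].  The recursion makes sense in every commutative ring and
    commutes with ring morphisms, so the same formula applies to generic and to
    specialized coefficients. *)
Fixpoint shift_quotient (R : comNzRingType) (m : R) (s : seq R) : R :=
  if s is a :: s' then \prod_(b <- s') b + (a - m) * shift_quotient m s' else 0.

Lemma shift_quotientE (R : comNzRingType) (m : R) (s : seq R) :
  m * shift_quotient m s = \prod_(a <- s) a - \prod_(a <- s) (a - m).
Proof.
elim: s => [|a s IHs] /=; first by rewrite !big_nil subrr mulr0.
by rewrite !big_cons mulrDr mulrCA IHs; ring.
Qed.

Lemma rmorph_shift_quotient (R S : comNzRingType) (h : {rmorphism R -> S}) (m : R)
    (s : seq R) :
  h (shift_quotient m s) = shift_quotient (h m) (map h s).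
Proof.
elim: s => [|a s IHs] /=; first by rewrite rmorph0.
by rewrite rmorphD rmorphM rmorphB IHs rmorph_prod big_map.
Qed.

Lemma dhomog_shift_quotient (R : comNzRingType) (n : nat) (m : {mpoly R[n]})
    (s : seq {mpoly R[n]}) :
  m \is 1.-homog -> all (fun p => p \is 1.-homog) s ->
  shift_quotient m s \is (size s).-1.-homog.
Proof.
move=> hm; elim: s => [|a s IHs] /=; first by rewrite dhomog0.
case/andP=> ha hs; apply: dhomogD.
  elim: s hs {IHs} => [|b s IHs] /=; first by rewrite big_nil dhomog1.
  by case/andP=> hb hs; rewrite big_cons -add1n; apply: dhomogM => //; apply: IHs.
case: s hs IHs => [|b s] hs IHs; first by rewrite mulr0 dhomog0.
by rewrite -[size (b :: s)]add1n; apply: dhomogM; [exact: rpredB | exact: IHs].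
Qed.

Definition grid_form (R : comNzRingType) (d : nat) (a : 'I_d.+1 -> 'rV[R]_3)
    (mu : 'rV[R]_3) : {mpoly R[3]} :=
  shift_quotient (lform (mu 0)) [seq lform (a i 0) | i <- enum 'I_d.+1].

Lemma grid_form_homog (R : comNzRingType) (d : nat) (a : 'I_d.+1 -> 'rV[R]_3)
    (mu : 'rV[R]_3) : grid_form a mu \is d.-homog.
Proof.
have := @dhomog_shift_quotient _ _ (lform (mu 0)) [seq lform (a i 0) | i <- enum 'I_d.+1].
rewrite size_map size_enum_ord; apply; first exact: lform_homog.
by apply/allP => _ /mapP[i _ ->]; exact: lform_homog.
Qed.

Lemma map_grid_form (R S : comNzRingType) (h : {rmorphism R -> S}) (d : nat)
    (a : 'I_d.+1 -> 'rV[R]_3) (mu : 'rV[R]_3) :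
  map_mpoly h (grid_form a mu) = grid_form (fun i => map_mx h (a i)) (map_mx h mu).
Proof.
rewrite /grid_form rmorph_shift_quotient /= map_lform -map_comp; congr shift_quotient.
  by apply: eq_lform => k; rewrite mxE.
apply: eq_map => i /=; rewrite map_lform; apply: eq_lform => k.
by rewrite mxE.
Qed.

(** The polynomials [Phi i] are read off from [grid_form] computed over the ring
    of polynomials in the parameters: the first variable is the scalar [c], the
    other ones are the coefficients of [mu] and of the [a i], in the rows of a
    matrix. *)
Lemma grid_form_parametrized (K : fieldType) (d : nat) :
  exists Phi : 'I_(\dim {:dhomog 3 K d}) -> {mpoly K[(d.+2 * 3).+1]},
  forall (f : dhomog 3 K d) (c : K) (a : 'I_d.+1 -> 'rV[K]_3) (mu : 'rV[K]_3),
    mpoly_of_dhomog f = c *: grid_form a mu ->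
    exists t, forall i, coord (vbasis {:dhomog 3 K d}) i f = (Phi i).@[t].
Proof.
pose A := {mpoly K[(d.+2 * 3).+1]}.
pose X (i : 'I_d.+2) : 'rV[A]_3 := \row_k 'X_(lift ord0 (mxvec_index i k)).
pose F := grid_form (fun i => X (lift ord0 i)) (X ord0).
pose mono (m : 'X_{1..3}) : dhomog 3 K d := indhomog d 'X_[m].
pose b := vbasis {:dhomog 3 K d}.
exists (fun i => \sum_(m : 'X_{1..3 < d.+1})
   (coord b i (mono m))%:MP * ('X_ord0 * F@_m)) => f c a mu fE.
have fsum : f = \sum_(m : 'X_{1..3 < d.+1}) (val f)@_m *: mono m.
  apply: val_inj; rewrite raddf_sum /=.
  rewrite [LHS](@mpolywE _ _ d.+1); last first.
    rewrite msizeE; apply/bigmax_leqP_seq => m mf _.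
    by have -> : mdeg m = d by exact: (dhomog_mf (dhomog_is_dhomog f) mf).
  apply: eq_bigr => m _; rewrite /mono /indhomog val_insubd dhomogX.
  case: eqP => // hm; rewrite (dhomog_nemf_coeff (dhomog_is_dhomog f)) ?scale0r //.
  by apply/eqP.
pose M : 'M[K]_(d.+2, 3) :=
  \matrix_(i, k) (if unlift ord0 i is Some j then a j 0 k else mu 0 k).
pose t x := if unlift ord0 x is Some y then mxvec M 0 y else c.
exists t => i.
have FE m : (F@_m).@[t] = (grid_form a mu)@_m.
  rewrite -(mcoeff_map_mpoly (meval t)) map_grid_form; congr (_@_ _).
  have XE j : map_mx (meval t) (X j) = row j M.
    by apply/rowP => k; rewrite !mxE mevalXU /t liftK mxvecE mxE.
  rewrite /grid_form !XE; congr shift_quotient.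
    by apply: eq_lform => k; rewrite !mxE unlift_none.
  apply: eq_map => j; apply: eq_lform => k.
  by rewrite XE !mxE liftK.
rewrite [in LHS]fsum !raddf_sum /=; apply: eq_bigr => m _.
rewrite linearZ !mevalM mevalC mevalXU FE /t unlift_none fE mcoeffZ.
by rewrite [LHS]mulrC.
Qed.

(** * Grids of points *)

(** The grid of the points where the red lines [l i] meet the blue lines [L j],
    with a representative [x i j] chosen for each of them. *)
Record point_grid (K : fieldType) (n : nat) (l L : 'I_n -> {vspace 'rV[K]_3})
    (x : 'I_n -> 'I_n -> 'rV[K]_3) : Prop := PointGrid {
  grid_red : forall i, \dim (l i) = 2%N;
  grid_blue : forall j, \dim (L j) = 2%N;
  grid_meet : forall i j, (l i :&: L j)%VS = <[x i j]>%VS;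
  grid_neq0 : forall i j, x i j != 0;
  grid_distinct : forall i j i' j', x i j \in <[x i' j']>%VS -> i = i' /\ j = j' }.

Lemma grid_on_red (K : fieldType) (n : nat) l L x (G : @point_grid K n l L x) i j i' :
  (x i j \in l i') = (i == i').
Proof.
have [xl xL] : x i j \in l i /\ x i j \in L j.
  by apply/andP; rewrite -memv_cap (grid_meet G) memv_line.
apply/idP/eqP => [xl'|<-//].
by have [] : i = i' /\ j = j by apply: (grid_distinct G); rewrite -(grid_meet G) memv_cap xl' xL.
Qed.

Lemma grid_on_blue (K : fieldType) (n : nat) l L x (G : @point_grid K n l L x) i j j' :
  (x i j \in L j') = (j == j').
Proof.
have [xl xL] : x i j \in l i /\ x i j \in L j.
  by apply/andP; rewrite -memv_cap (grid_meet G) memv_line.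
apply/idP/eqP => [xL'|<-//].
by have [] : i = i /\ j = j' by apply: (grid_distinct G); rewrite -(grid_meet G) memv_cap xl xL'.
Qed.

Lemma grid_parallel (K : fieldType) (n : nat) l L x (G : @point_grid K n l L x)
    i j i' j' : (x i j \in <[x i' j']>%VS) = (i == i') && (j == j').
Proof.
apply/idP/andP => [/(grid_distinct G)[-> ->]|[/eqP-> /eqP->]] //.
exact: memv_line.
Qed.

(** The line [l ord0] carries d + 1 given zeros.  Any other [l i] carries d given
    zeros, and its intersection with [l ord0] is one more, because no grid point
    lies on two red lines. *)
Lemma grid_vanish_red (K : numFieldType) (d : nat) l L x
    (G : @point_grid K d.+1 l L x) (f : {mpoly K[3]}) :
  (0 < d)%N -> f \is d.-homog -> (forall i j, i != j -> f.@[x i j 0] = 0) ->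
  f.@[x ord0 ord0 0] = 0 -> forall i q, q \in l i -> f.@[q 0] = 0.
Proof.
move=> d0 hf fx fx0.
have red0 q : q \in l ord0 -> f.@[q 0] = 0.
  apply: (homog_vanish_line (x := x ord0) d0 hf (grid_red G _)) => [j|j k jk|j].
  - by rewrite (grid_on_red G).
  - by rewrite (grid_parallel G) eqxx.
  - by have [->|j0] := eqVneq j ord0; [|rewrite fx // eq_sym].
move=> i q; have [->|i0] := eqVneq i ord0; first exact: red0.
have [o o0 /andP[oi ored0]] := meet_lines (grid_red G i) (grid_red G ord0).
have xo j : x i j \notin <[o]>%VS.
  apply/negP => /vlineP[c xE]; case/negP: i0.
  by rewrite -(grid_on_red G i j) xE memvZ.
pose y j := if j == i then o else x i j.
apply: (homog_vanish_line (x := y) d0 hf (grid_red G _)) => [j|j k jk|j]; rewrite /y.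
- by case: eqP => // _; rewrite (grid_on_red G).
- case: (eqVneq j i) => [ji|ji]; case: (eqVneq k i) => [ki|ki] //.
  + by rewrite ji ki eqxx in jk.
  + by apply: contra (xo k); exact: mem_vlineC.
  + by rewrite (grid_parallel G) negb_and jk orbT.
- by case: (eqVneq j i) => [_|ji]; [exact: red0 | rewrite fx // eq_sym].
Qed.

Lemma grid_vanish (K : numFieldType) (d : nat) l L x
    (G : @point_grid K d.+1 l L x) (f : {mpoly K[3]}) :
  (0 < d)%N -> f \is d.-homog -> (forall i j, i != j -> f.@[x i j 0] = 0) ->
  f.@[x ord0 ord0 0] = 0 -> f = 0.
Proof.
move=> d0 hf fx fx0; apply: (homog_vanish_lines d0 hf (grid_red G)).
  move=> i j ij; apply/subvPn; exists (x i i); rewrite (grid_on_red G) //.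
exact: grid_vanish_red G _ d0 hf fx fx0.
Qed.

(** With [r] a second point of [l i] and [s] a second point of [L i], the equation
    of [l i] is scaled so as to agree with [mu] at [s].  Its difference with [mu]
    then vanishes at [s] and at the diagonal point, both on [L i], and it is not
    zero because at [r] it equals the opposite of [mu]. *)
Lemma grid_forms (K : fieldType) (d : nat) l L x (G : @point_grid K d.+1 l L x)
    (m : {vspace 'rV[K]_3}) :
  (0 < d)%N -> \dim m = 2%N -> (forall i, x i i \in m) ->
  exists (a : 'I_d.+1 -> 'rV[K]_3) (mu : 'rV[K]_3),
    [/\ m = formker mu, forall i, l i = formker (a i)
      & forall i, L i = formker (a i - mu)].
Proof.
move=> d0 dm xm; have [mu mu0 mE] := line_form dm.
have other (i : 'I_d.+1) : exists j, j != i.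
  have [->|i0] := eqVneq i ord0; last by exists ord0; rewrite eq_sym.
  by exists ord_max; rewrite -val_eqE /= -lt0n.
have mred i : l i != m.
  have [j ij] := other i; apply: contra ij => /eqP lm.
  by have := xm j; rewrite -lm (grid_on_red G).
have mblue i : L i != m.
  have [j ij] := other i; apply: contra ij => /eqP lm.
  by have := xm j; rewrite -lm (grid_on_blue G).
have aP i : exists a, l i = formker a /\ L i = formker (a - mu).
  have [j ij] := other i; have [b b0 lE] := line_form (grid_red G i).
  pose r := x i j; pose s := x j i.
  have xi0 := grid_neq0 G i i.
  have rl : r \in l i by rewrite (grid_on_red G).
  have sL : s \in L i by rewrite (grid_on_blue G).
  have xl : x i i \in l i by rewrite (grid_on_red G).
  have xL : x i i \in L i by rewrite (grid_on_blue G).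
  have rx : r \notin <[x i i]>%VS by rewrite (grid_parallel G) (negPf ij) andbF.
  have sx : s \notin <[x i i]>%VS by rewrite (grid_parallel G) (negPf ij).
  have mur : dot mu r != 0.
    rewrite -mem_formker -mE; apply: contra (mred i) => rm.
    by rewrite (line_through dm xi0 (xm i) rm rx)
      (line_through (grid_red G i) xi0 xl rl rx).
  have mus : dot mu s != 0.
    rewrite -mem_formker -mE; apply: contra (mblue i) => sm.
    by rewrite (line_through dm xi0 (xm i) sm sx)
      (line_through (grid_blue G i) xi0 xL sL sx).
  have bs : dot b s != 0.
    by rewrite -mem_formker -lE (grid_on_red G).
  pose c := dot mu s / dot b s.
  have c0 : c != 0 by rewrite mulf_neq0 ?invr_neq0.
  exists (c *: b); split.
    by rewrite lE; apply/vspaceP => w; rewrite !mem_formker dotZ mulf_eq0 (negPf c0).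
  have dot_red w : w \in l i -> dot b w = 0 by rewrite lE mem_formker => /eqP.
  have a0 : c *: b - mu != 0.
    apply: contra mur => /eqP e; have := dotB (c *: b) mu r.
    by rewrite e dot0 dotZ dot_red // mulr0 sub0r => /esym/eqP; rewrite oppr_eq0.
  rewrite (line_through (grid_blue G i) xi0 xL sL sx); apply/esym.
  apply: (line_through (dim_formker a0) xi0) => //; rewrite mem_formker dotB dotZ.
    rewrite dot_red // mulr0 sub0r oppr_eq0 -mem_formker -mE; exact: xm.
  by rewrite divfK // subrr.
have [a aE] := fin_all_exists aP.
by exists a, mu; split=> // i; case: (aE i).
Qed.

Lemma grid_form_vanish (K : fieldType) (d : nat) l L x
    (G : @point_grid K d.+1 l L x) (a : 'I_d.+1 -> 'rV[K]_3) (mu : 'rV[K]_3) i j :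
  (forall i, l i = formker (a i)) -> (forall i, L i = formker (a i - mu)) ->
  i != j -> (grid_form a mu).@[x i j 0] = 0.
Proof.
move=> lE LE ij.
have ai : dot (a i) (x i j) = 0.
  by apply/eqP; rewrite -mem_formker -lE (grid_on_red G).
have bj : dot (a j - mu) (x i j) = 0.
  by apply/eqP; rewrite -mem_formker -LE (grid_on_blue G).
have muij : dot mu (x i j) != 0.
  have : dot (a i - mu) (x i j) != 0.
    by rewrite -mem_formker -LE (grid_on_blue G) eq_sym.
  by rewrite dotB ai sub0r oppr_eq0.
apply: (mulfI muij); rewrite mulr0 /grid_form rmorph_shift_quotient /= lform_dot shift_quotientE.
rewrite !big_map -!enumT !big_enum (bigD1 i) //= lform_dot ai mul0r.
by rewrite (bigD1 j) //= lform_dot -dotB bj mul0r subrr.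
Qed.

(** In the recursive formula for [grid_form], every term but the first contains
    the factor [a ord0 - mu], an equation of [L ord0]; the first is the product of
    the equations of the other red lines. *)
Lemma grid_form_neq0 (K : fieldType) (d : nat) l L x
    (G : @point_grid K d.+1 l L x) (a : 'I_d.+1 -> 'rV[K]_3) (mu : 'rV[K]_3) :
  (forall i, l i = formker (a i)) -> (forall i, L i = formker (a i - mu)) ->
  (grid_form a mu).@[x ord0 ord0 0] != 0.
Proof.
move=> lE LE.
have b0 : dot (a ord0 - mu) (x ord0 ord0) = 0.
  by apply/eqP; rewrite -mem_formker -LE (grid_on_blue G).
rewrite /grid_form enum_ordSl rmorph_shift_quotient /= !lform_dot -dotB b0 mul0r addr0.
rewrite prodf_seq_neq0 -!map_comp all_map; apply/allP => i _ /=.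
by rewrite lform_dot -mem_formker -lE (grid_on_red G).
Qed.

(** * Constructible curves *)

Lemma proj_vline (K : fieldType) (V : vectType K) (P : proj V) :
  vpick (val P) != 0 /\ val P = <[vpick (val P)]>%VS.
Proof.
have /eqP dP : \dim (val P) == 1%N by exact: (valP P).
have v0 : vpick (val P) != 0 by rewrite vpick0 -dimv_eq0 dP.
split=> //; apply/eqP; rewrite eq_sym eqEdim -memvE memv_pick.
by rewrite dP dim_vline v0.
Qed.

Lemma constructible_grid_form (K : numFieldType) (d : nat) (X : curve K d)
    (f : dhomog 3 K d) :
  (0 < d)%N -> constructible X -> f \in val X -> f != 0 ->
  exists c (a : 'I_d.+1 -> 'rV[K]_3) mu, mpoly_of_dhomog f = c *: grid_form a mu.
Proof.
move=> d0 [l [L [p [pE pI [m pm] pX]]]] fX f0.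
pose x i j := vpick (val (p i j)).
have xE i j : val (p i j) = <[x i j]>%VS by case: (proj_vline (p i j)).
have x0 i j : x i j != 0 by case: (proj_vline (p i j)).
have G : point_grid (fun i => val (l i)) (fun j => val (L j)) x.
  split=> // [i|j|i j|i j i' j' xx].
  - by apply/eqP; exact: (valP (l i)).
  - by apply/eqP; exact: (valP (L j)).
  - by rewrite -xE pE.
  - apply: pI; apply/val_inj; rewrite !xE; apply/eqP.
    by rewrite eqEdim -memvE xx !dim_vline !x0.
have dm : \dim (val m) = 2%N by apply/eqP; exact: (valP m).
have xm i : x i i \in val m.
  by have := pm i; rewrite /on_line xE -memvE.
have [a [mu [_ lE LE]]] := grid_forms G d0 dm xm.
have fx i j : i != j -> (mpoly_of_dhomog f).@[x i j 0] = 0.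
  by move=> /eqP ij; apply: (pX i j ij) => //; rewrite xE memv_line.
have fhom := dhomog_is_dhomog f.
pose F := grid_form a mu.
have F0 : F.@[x ord0 ord0 0] != 0 by exact: (grid_form_neq0 G lE LE).
pose c := (mpoly_of_dhomog f).@[x ord0 ord0 0] / F.@[x ord0 ord0 0].
exists c, a, mu; apply/eqP; rewrite -subr_eq0; apply/eqP.
apply: (grid_vanish G d0) => [|i j ij|].
- by apply: rpredB; [|apply: rpredZ; exact: grid_form_homog].
- by rewrite mevalB mevalZ fx // (grid_form_vanish G lE LE) // mulr0 subrr.
- by rewrite mevalB mevalZ divfK // subrr.
Qed.

Lemma dim_dhomog3 (K : fieldType) (d : nat) :
  \dim {:dhomog 3 K d} = 'C(d.+2, 2).
Proof.
have -> : \dim {:dhomog 3 K d} = 'C(d + 2, d) by rewrite dimvf.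
by rewrite -bin_sub ?leq_addr // addKn addn2.
Qed.

Lemma constructible_not_dense (K : numFieldType) (d : nat) :
  (6 <= d)%N -> ~ construction_dense K d.
Proof.
move=> d6 [U [openU [X UX] Uc]]; have d0 : (0 < d)%N by apply: leq_trans d6.
have [Phi PhiP] := grid_form_parametrized K d.
apply: (open_not_parametrized (Phi := Phi)) openU _ _ => [||{UX}X UX f fX f0].
- by rewrite dim_dhomog3 bin2 geq_half_double -mul2n; nia.
- by exists X.
have [c [a [mu fE]]] := constructible_grid_form d0 (Uc X UX) fX f0.
exact: PhiP fE.
Qed.

Theorem mainTheorem6 (R : realType) (d : nat) (hd : (6 <= d)%N) :
  ~ construction_dense R[i] d.
Proof. exact: constructible_not_dense. Qed.
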